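(* Let $A$ be a unital commutative $\mathbb R$-algebra with $X(A)\neq\varnothing$, let $L:A\to\mathbb R$ be a linear functional with $L(1)=1$, and let $(T_a)_{a\in A}$ be a family of positive real numbers. The following conditions are equivalent: (i) for every $a\in A$, $$L\big((T_a-a)^p(T_a+a)^q\big)\ge 0\quad\text{for all } p,q\in\mathbb N_0;$$ (ii) there is a positive Radon measure $\mu$ on the compact set $$K=\{\alpha\in X(A): |\alpha(a)|\le T_a \text{ for all } a\in A\}$$ such that $$L(a)=\int_K \alpha(a)\,d\mu(\alpha)\quad\text{for all } a\in A.$$
   Context: $\mathbb N_0=\{0,1,2,\dots\}$. For a unital commutative $\mathbb R$-algebra $A$, $X(A)$ denotes the set of all (unital) $\mathbb R$-algebra homomorphisms $A\to\mathbb R$, endowed with the topology of pointwise convergence. A real number $t$ is identified with $t\cdot 1\in A$, and $a^0=1$. *)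

(* Defs.v *)
From HB Require Import structures.
From mathcomp Require Import all_boot all_order all_algebra.
From mathcomp Require Import all_classical all_reals all_analysis.

Set Implicit Arguments.
Unset Strict Implicit.
Unset Printing Implicit Defensive.
Import Order.TTheory GRing.Theory Num.Theory.
Import numFieldNormedType.Exports.
Local Open Scope classical_set_scope.
Local Open Scope ring_scope.

(* Measurable types of the library are pointed, whereas a subspace carries no
   canonical point (and may be empty): the point x0 is supplied explicitly.
   It plays no role in the sigma-algebra. *)
Definition pointed_at (T : topologicalType) (x0 : T) : Type := T.

HB.instance Definition _ (T : topologicalType) (x0 : T) :=
  Choice.copy (pointed_at x0) T.
HB.instance Definition _ (T : topologicalType) (x0 : T) :=
  isPointed.Build (pointed_at x0) x0.

Definition borel_type (T : topologicalType) (x0 : T) :=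
  g_sigma_algebraType ((@open T) : set (set (pointed_at x0))).

(* Meant for a Hausdorff T, where compact sets are Borel. *)
Definition radon_measure (R : realType) (T : topologicalType) (x0 : T)
    (mu : {measure set (borel_type x0) -> \bar R}) : Prop :=
  (forall C : set T, compact C -> (mu C < +oo)%E) /\
  (forall B : set (borel_type x0), measurable B ->
    mu B = ereal_sup [set mu C | C in [set C : set T | compact C /\ C `<=` B]]).

Definition characters (R : realType) (A : comAlgType R) : set {ptws A -> R} :=
  range (fun f : {lrmorphism A -> R^o} => f : A -> R).
Arguments characters {R} A.

Definition bounded_characters (R : realType) (A : comAlgType R) (T : A -> R) :
    set {ptws A -> R} :=
  [set alpha | characters A alpha /\ forall a : A, `|alpha a| <= T a].

Lemma charactersP (R : realType) (A : comAlgType R) (alpha : {ptws A -> R}) :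
  characters A alpha <->
  [/\ alpha 1 = 1, forall a b, alpha (a * b) = alpha a * alpha b
    & forall (c : R) a b, alpha (c *: a + b) = c * alpha a + alpha b].
Proof.
split=> [[f _ <-]|[f1 fM fL]].
  by split=> [|a b|c a b]; rewrite ?rmorph1 ?rmorphM ?linearP.
have lin : linear (alpha : A -> R^o) by [].
have mul : monoid_morphism (alpha : A -> R^o) by [].
pose aL := GRing.isLinear.Build R A R^o *:%R (alpha : A -> R^o) lin.
pose aM := GRing.isMonoidMorphism.Build A R^o (alpha : A -> R^o) mul.
pose f : {lrmorphism A -> R^o} := HB.pack (alpha : A -> R^o) aL aM.
by exists f.
Qed.

Lemma bounded_characters_compact (R : realType) (A : comAlgType R)
  (T : A -> R) : compact (bounded_characters T).
Proof.
have ev (a : A) : continuous (fun f : {ptws A -> R} => f a).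
  exact: (@proj_continuous A (fun=> R) a).
have closed0 (h : {ptws A -> R} -> R) : continuous h ->
    closed [set f | h f = 0].
  by move=> ch; exact: (proj1 (continuous_closedP _) ch _ (@closed_eq R 0)).
pose box : set {ptws A -> R} := [set f | forall a, `[- T a, T a]%classic (f a)].
apply: (@subclosed_compact _ _ box); first last.
- by move=> f [_ fT] a /=; rewrite in_itv /= -ler_norml.
- apply: (@tychonoff A (fun=> R) (fun a => `[- T a, T a]%classic)) => a.
  exact: segment_compact.
have -> : bounded_characters T =
    [set f : {ptws A -> R} | f 1 - 1 = 0] `&`
    \bigcap_(ab in [set: A * A])
      [set f : {ptws A -> R} | f (ab.1 * ab.2) - f ab.1 * f ab.2 = 0] `&`
    \bigcap_(cab in [set: R * (A * A)])
      [set f : {ptws A -> R} | f (cab.1 *: cab.2.1 + cab.2.2)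
        - (cab.1 * f cab.2.1 + f cab.2.2) = 0] `&`
    \bigcap_(a in [set: A])
      (fun f : {ptws A -> R} => `|f a|) @^-1` [set x | x <= T a].
  apply/seteqP; split=> f.
    case=> /charactersP[f1 fM fL] fT; split; last by move=> a _; exact: fT.
    split; first split.
    - by rewrite /= f1 subrr.
    - by move=> [a b] _ /=; rewrite fM subrr.
    - by move=> [c [a b]] _ /=; rewrite fL subrr.
  move=> [[[/eqP + fM] fL] fT]; rewrite subr_eq0 => /eqP f1.
  split; last by move=> a; exact: fT.
  apply/charactersP; split=> // [a b|c a b].
  - by have /eqP := fM (a, b) I; rewrite subr_eq0 => /eqP.
  - by have /eqP := fL (c, (a, b)) I; rewrite subr_eq0 => /eqP.
apply: closedI; [apply: closedI; [apply: closedI|]|].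
- apply: (closed0 (fun f => f 1 - 1)) => f.
  exact: (cvgB (ev 1 f) (cvg_cst (1 : R))).
- apply: closed_bigI => -[a b] _.
  apply: (closed0 (fun f => f (a * b) - f a * f b)) => f.
  exact: (cvgB (ev (a * b) f) (cvgM (ev a f) (ev b f))).
- apply: closed_bigI => -[c [a b]] _.
  apply: (closed0 (fun f => f (c *: a + b) - (c * f a + f b))) => f.
  exact: (cvgB (ev (c *: a + b) f)
            (cvgD (cvgM (cvg_cst c) (ev a f)) (ev b f))).
- apply: closed_bigI => a _.
  apply: (proj1 (continuous_closedP _) _ _ (@closed_le R _)) => f.
  exact: (cvg_norm (ev a f)).
Qed.

Lemma bounded_characters_hausdorff (R : realType) (A : comAlgType R)
  (T : A -> R) : hausdorff_space (bounded_characters T).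
Proof.
have hP : hausdorff_space {ptws A -> R}.
  by apply: (@hausdorff_product A (fun=> R)) => a; exact: Rhausdorff.
move=> x y xy; apply: val_inj; apply: hP => U V xU yV.
have [z [zU zV]] := xy (set_val @^-1` U) (set_val @^-1` V)
  (@initial_continuous _ _ set_val x _ xU) (@initial_continuous _ _ set_val y _ yV).
by exists (set_val z).
Qed.

(* Main.v *)
(* Idea. For a single [a], positivity of [L] on the products [(T a - a)^p (T a + a)^q]
   forces [0 <= L (a^2)] and [L (a^n) <= (T a)^n]. Iterating Cauchy-Schwarz in the
   semi-inner product [L (y z)] shows that multiplication by [x] has norm at most
   [T x], so that [L] is nonnegative on the whole semiring generated by the
   nonnegative scalars and the elements [T x + x], [T x - x]. This semiring is
   archimedean, and its nonnegative characters are those of [K]; by the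
   Kadison-Dubois representation theorem it contains every element positive on
   [K], hence [L] is nonnegative on elements nonnegative on [K]. By Hahn-Banach,
   [L] extends to a positive functional on the bounded functions on [K], i.e. to
   the integral against a finitely additive [nu]. The Caratheodory measure of the
   outer measure [inf_(U open) sup_(C closed in U) nu C] is Radon and dominates
   [nu] on closed sets, so [L a <= \int a] by cutting [a] into layers, with
   equality because the same holds for [- a]. *)
Require Import Defs.
From HB Require Import structures.
From mathcomp Require Import all_boot all_order all_algebra.
From mathcomp Require Import all_classical all_reals all_analysis.
From mathcomp Require Import measurable_realfun ring lra.

Set Implicit Arguments.
Unset Strict Implicit.
Unset Printing Implicit Defensive.
Import Order.TTheory GRing.Theory Num.Theory.
Import numFieldNormedType.Exports.
Local Open Scope classical_set_scope.
Local Open Scope ring_scope.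

(** * Moments on an interval *)

Lemma quad_form_ge0_discr (R : realType) (a b c : R) :
  (forall s t, 0 <= s ^+ 2 * a + s * t * b *+ 2 + t ^+ 2 * c) ->
  b ^+ 2 <= a * c.
Proof.
move=> H.
have a0 : 0 <= a by have := H 1 0; rewrite !(expr0n, mulr0, mul0r, addr0, mul0rn)/= expr1n mul1r.
have [a1|a1] := ltP 0 a.
  have := H (- b) a.
  have -> : (- b) ^+ 2 * a + - b * a * b *+ 2 + a ^+ 2 * c = a * (a * c - b ^+ 2).
    by ring.
  by rewrite pmulr_rge0// subr_ge0.
have a00 : a = 0 by apply/eqP; rewrite eq_le a0 a1.
rewrite a00 mul0r in H *.
have [->|b0] := eqVneq b 0; first by rewrite expr0n.
(* With [a = 0] and [t = 1] the form is affine in [s] with slope [2 b]; this [s] gives it the value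
   [-1]. *)
have := H (- (c + 1) / (b *+ 2)) 1.
have -> : (- (c + 1) / (b *+ 2)) ^+ 2 * 0 + - (c + 1) / (b *+ 2) * 1 * b *+ 2 +
  1 ^+ 2 * c = - 1 by field.
by rewrite lerNr oppr0 ler10.
Qed.

Lemma exprn_unbounded (R : realType) (r C : R) :
  1 < r -> exists n, C < r ^+ n.
Proof.
move=> r1.
have bern n : 1 + n%:R * (r - 1) <= r ^+ n.
  elim: n => [|n IH]; first by rewrite mul0r addr0 expr0.
  rewrite exprS (le_trans _ (ler_wpM2l _ IH))//; last by lra.
  have -> : r * (1 + n%:R * (r - 1)) =
    1 + n.+1%:R * (r - 1) + n%:R * (r - 1) ^+ 2 by rewrite -natr1; ring.
  by rewrite lerDl mulr_ge0// sqr_ge0.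
have [n Cn] : exists n : nat, C / (r - 1) < n%:R.
  by exists (Num.truncn `|C / (r - 1)|).+1; rewrite (le_lt_trans (ler_norm _))// truncnS_gt.
exists n; rewrite (lt_le_trans _ (bern n))//.
by move: Cn; rewrite ltr_pdivrMr ?subr_gt0//; lra.
Qed.

(** Writing [U 0 = P (t r)], each use of the squaring inequality doubles the exponent, so
    [U n >= P (t r)^(2^n)]. If [r > 1], this eventually exceeds [C t^(2^n)]. *)
Lemma sqr_growth_le (R : realType) (P t C : R) (U : nat -> R) :
  0 <= P -> 0 < t ->
  (forall n, U n ^+ 2 <= P * U n.+1) ->
  (forall n, U n.+1 <= C * t ^+ (2 ^ n.+1)) ->
  U 0%N <= t * P.
Proof.
move=> P0 t0 UU UC; rewrite leNgt; apply/negP => tPU.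
have {}P0 : 0 < P.
  rewrite lt_neqAle P0 andbT eq_sym; apply/negP => /eqP P00.
  by have := UU 0%N; rewrite P00 mul0r leNgt exprn_gt0// (le_lt_trans _ tPU)// P00 mulr0.
pose r := U 0%N / (t * P).
have r1 : 1 < r by rewrite ltr_pdivlMr ?mulr_gt0// mul1r.
have Ur n : P * (t * r) ^+ (2 ^ n) <= U n.
  elim: n => [|n IH].
    rewrite expn0 expr1 /r le_eqVlt; apply/orP; left; apply/eqP.
    by field; rewrite !gt_eqF.
  rewrite -(ler_pM2l P0) (le_trans _ (UU n))// expnSr exprM mulrA -expr2 -exprMn.
  have Ptr : 0 <= P * (t * r) ^+ (2 ^ n).
    by rewrite ltW// mulr_gt0// exprn_gt0// mulr_gt0// (lt_trans ltr01).
  by apply: lerXn2r; rewrite ?nnegrE//; exact: le_trans Ptr IH.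
have [n] := exprn_unbounded (C / P) r1.
apply/negP; rewrite -leNgt ler_pdivlMr//.
have := le_trans (Ur n.+1) (UC n).
rewrite exprMn mulrCA mulrC ler_pM2r ?exprn_gt0// => {}H.
rewrite (le_trans _ H)// mulrC ler_pM2l// ler_eXn2l//.
by rewrite ltnW// (ltn_trans _ (ltn_expl n.+1 _)).
Qed.

Section interval_moments.
Variables (R : realType) (A : comAlgType R) (L : {scalar A}) (u v : A).
Hypotheses (uv1 : u + v = 1) (Luv : forall k l, 0 <= L (u ^+ k * v ^+ l)).

(** Quantifying over all [k] and [l] makes the condition stable under multiplication by [u] and [v],
    on which the inductions below rely. *)
Let pos x := forall k l, 0 <= L (u ^+ k * v ^+ l * x).

Let posD x y : pos x -> pos y -> pos (x + y).
Proof. by move=> px py k l; rewrite mulrDr linearD addr_ge0. Qed.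

Let pos_u x : pos x -> pos (u * x).
Proof. by move=> px k l; have := px k.+1 l; rewrite exprS; congr (0 <= L _); ring. Qed.

Let pos_v x : pos x -> pos (v * x).
Proof. by move=> px k l; have := px k l.+1; rewrite exprS; congr (0 <= L _); ring. Qed.

Let posC (c : R) : 0 <= c -> pos c%:A.
Proof. by move=> c0 k l; rewrite -scalerAr mulr1 linearZ /= mulr_ge0. Qed.

Let pos_ge0 x : pos x -> 0 <= L x.
Proof. by move=> /(_ 0%N 0%N); rewrite !expr0 !mul1r. Qed.

(* The element is [\sum_k 'C(n, k) (c + 2k - n)^2 v^k u^(n-k)], i.e. the second
   moment of a random walk started at [c], in closed form. *)
Lemma second_moment_pos n (c : R) :
  pos (in_alg A c ^+ 2 + in_alg A c * n%:R * (v - u) *+ 2 + n%:R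
       + (n%:R ^+ 2 - n%:R) * (v - u) ^+ 2).
Proof.
elim: n c => [|n IH] c.
  rewrite mulr0 mul0r mul0rn expr0n subrr mul0r !addr0 -rmorphXn.
  exact/posC/sqr_ge0.
(* Condition on the first step of the walk, to [c + 1] with weight [v] and to [c - 1] with weight
   [u]. *)
have := posD (pos_v (IH (c + 1))) (pos_u (IH (c - 1))).
congr pos; rewrite -natr1 rmorphB rmorphD rmorph1.
have -> : u = 1 - v by rewrite -uv1 addrK.
by ring.
Qed.

(** For the walk started at 0 the second moment is [n + (n^2 - n) (v - u)^2]. Its quadratic term
    dominates for large [n], so the coefficient of that term cannot be negative under [L]. *)
Lemma moment2_ge0 : 0 <= L ((v - u) ^+ 2).
Proof.
set s := L _; rewrite leNgt; apply/negP => s0.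
have H n : 0 <= n%:R * L 1 + (n%:R ^+ 2 - n%:R) * s.
  have := pos_ge0 (second_moment_pos n 0).
  rewrite rmorph0 expr0n !mul0r mul0rn !add0r.

  have -> : n%:R + (n%:R ^+ 2 - n%:R) * (v - u) ^+ 2 =
      n%:R *: 1 + (n%:R ^+ 2 - n%:R) *: (v - u) ^+ 2 :> A.
    have algE c (x : A) : c *: x = in_alg A c * x by rewrite mulr_algl.
    by rewrite !algE mulr1 rmorphB rmorphXn !rmorph_nat.
  by rewrite linearD !linearZ.
have [n sn] : exists n : nat, L 1 / - s < n%:R.
  by exists (Num.truncn `|L 1 / - s|).+1; rewrite (le_lt_trans (ler_norm _))// truncnS_gt.
have := H n.+1; rewrite -natr1.
have -> : (n%:R + 1) * L 1 + ((n%:R + 1) ^+ 2 - (n%:R + 1)) * s =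
  (n%:R + 1) * (L 1 + n%:R * s) by ring.
rewrite natr1 pmulr_rge0// leNgt => /negP; apply.
by move: sn; rewrite ltr_pdivrMr ?oppr_gt0//; lra.
Qed.

(** With [w = v - u], each of [1 + w^(n+1)] and [1 - w^(n+1)] is a combination, with weights [v] and
    [u], of the same two elements at [n]; hence the joint induction on both signs. *)
Lemma moment_le n : L ((v - u) ^+ n) <= L 1.
Proof.
have posE : pos (1 + (v - u) ^+ n) /\ pos (1 - (v - u) ^+ n).
  have pos1 : pos 1 by have := posC ler01; rewrite scale1r.
  elim: n => [|n [IHp IHn]].
    rewrite expr0 subrr; split; first exact: posD.
    by have := posC (lexx 0); rewrite scale0r.
  have -> : 1 + (v - u) ^+ n.+1 = v * (1 + (v - u) ^+ n) + u * (1 - (v - u) ^+ n).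
    by rewrite exprS -[in LHS]uv1; ring.
  have -> : 1 - (v - u) ^+ n.+1 = v * (1 - (v - u) ^+ n) + u * (1 + (v - u) ^+ n).
    by rewrite exprS -[X in X - _]uv1; ring.
  by split; apply: posD; (exact: pos_u || exact: pos_v).
by have /pos_ge0 := posE.2; rewrite linearB subr_ge0.
Qed.

End interval_moments.

(** * Products of several generators *)

Section tame.
Variables (R : realType) (A : comAlgType R) (L : {scalar A}) (T : A -> R).
Hypothesis T_gt0 : forall a, 0 < T a.

(* [b] is tame when the functional [L (b * -)] is positive on squares and grows
   along the powers of each [x] at most like those of [T x]; by iterated
   Cauchy-Schwarz, multiplication by [x] then has norm at most [T x] for the
   semi-inner product [L (b y z)]. *)
Definition tame (b : A) : Prop :=
  (forall y, 0 <= L (b * y ^+ 2)) /\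
  (forall x y, exists C, forall n,
     L (b * x ^+ (2 ^ n.+1) * y ^+ 2) <= C * T x ^+ (2 ^ n.+1)).

Lemma tame_schwarz b p q : tame b ->
  L (b * p * q) ^+ 2 <= L (b * p ^+ 2) * L (b * q ^+ 2).
Proof.
move=> [b0 _]; apply: quad_form_ge0_discr => s t.
have := b0 (s *: p + t *: q).
have algE c (x : A) : c *: x = in_alg A c * x by rewrite mulr_algl.
have -> : b * (s *: p + t *: q) ^+ 2 = (s ^+ 2) *: (b * p ^+ 2) +
    (s * t *+ 2) *: (b * p * q) + (t ^+ 2) *: (b * q ^+ 2).
  by rewrite !algE !rmorphXn rmorphMn rmorphM; ring.
by rewrite !linearD !linearZ /= mulrnAl.
Qed.

Lemma tame_bound b x y : tame b ->
  L (b * x * y ^+ 2) <= T x * L (b * y ^+ 2) /\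
  - L (b * x * y ^+ 2) <= T x * L (b * y ^+ 2).
Proof.
move=> tb; have [b0 bC] := tb; have [C {}bC] := bC x y.
(* The growth bound involves only the powers [2^(n+1)], which are blind to the sign of [x], so
   [z = x] and [z = - x] are treated together. Cauchy-Schwarz for [z^(2^n) y] and [y] gives the
   squaring inequality. *)
have bound z : z ^+ 2 = x ^+ 2 -> L (b * z * y ^+ 2) <= T x * L (b * y ^+ 2).
  move=> zx.
  have zxn n : z ^+ (2 ^ n.+1) = x ^+ (2 ^ n.+1) by rewrite expnS !exprM zx.
  apply: (@sqr_growth_le _ _ _ C (fun n => L (b * z ^+ (2 ^ n) * y ^+ 2))) => //.
    move=> n; have := tame_schwarz (z ^+ (2 ^ n) * y) y tb.
    rewrite expnSr exprM; set p := z ^+ (2 ^ n); rewrite [_ * L (b * y ^+ 2)]mulrC.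
    have -> : b * (p * y) * y = b * p * y ^+ 2 by ring.
    by have -> : b * (p * y) ^+ 2 = b * p ^+ 2 * y ^+ 2 by ring.
  by move=> n; rewrite zxn.
split; first exact: bound.
by have := bound (- x); rewrite sqrrN mulrN mulNr linearN; apply.
Qed.

Lemma tameD b c : tame b -> tame c -> tame (b + c).
Proof.
move=> [b0 bC] [c0 cC]; split=> [y|x y].
  by rewrite mulrDl linearD addr_ge0.
have [C1 H1] := bC x y; have [C2 H2] := cC x y.
by exists (C1 + C2) => n; rewrite !mulrDl linearD; exact: lerD.
Qed.

Lemma tameZ b (k : R) : 0 <= k -> tame b -> tame (k *: b).
Proof.
move=> k0 [b0 bC]; split=> [y|x y].
  by rewrite -scalerAl linearZ mulr_ge0.
have [C1 H1] := bC x y.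
exists (k * C1) => n.
have -> : k *: b * x ^+ (2 ^ n.+1) * y ^+ 2 =
  k *: (b * x ^+ (2 ^ n.+1) * y ^+ 2) by rewrite -!scalerAl.
by rewrite linearZ -[leRHS]mulrA ler_wpM2l.
Qed.

(** [tame_bound] puts [L (b (T x + z) y^2)], for [z = x] or [z = - x], between 0 and
    [2 T x L (b y^2)]. The lower bound is positivity on squares; the upper one, taken at
    [w^(2^n) y], transfers the growth bound of [b] at the cost of a factor [2 T x]. *)
Lemma tame_gen b x : tame b ->
  tame (b * ((T x)%:A + x)) /\ tame (b * ((T x)%:A - x)).
Proof.
move=> tb.
have H z : z = x \/ z = - x -> tame (b * ((T x)%:A + z)).
  move=> zx.
  have bz y : 0 <= L (b * ((T x)%:A + z) * y ^+ 2) <= (T x *+ 2) * L (b * y ^+ 2).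
    have [] := tame_bound x y tb.
    have -> : b * ((T x)%:A + z) * y ^+ 2 = T x *: (b * y ^+ 2) + b * z * y ^+ 2.
      by rewrite mulrDr mulr_algr mulrDl scalerAl.
    rewrite linearD linearZ /=.
    by case: zx => ->; rewrite ?(mulrN, mulNr, linearN); lra.
  split=> [y|w y]; first by have /andP[] := bz y.
  have [_ /(_ w y)[C bC]] := tb.
  exists (T x *+ 2 * C) => n.
  have /andP[_] := bz (w ^+ (2 ^ n) * y).
  rewrite exprMn -exprM mulnC -expnS !(mulrA _ _ (y ^+ 2)).
  by move=> /le_trans -> //; rewrite -[leRHS]mulrA ler_wpM2l// mulrn_wge0// ltW.
by split; apply: H; [left|right].
Qed.

(** Tameness itself is not visibly closed under products, whereas the multipliers that preserve it
    compose. *)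
Definition tame_stable (b : A) : Prop := forall c, tame c -> tame (c * b).

Lemma tame_stableD b c : tame_stable b -> tame_stable c -> tame_stable (b + c).
Proof. by move=> hb hc d td; rewrite mulrDr; apply: tameD; [apply: hb|apply: hc]. Qed.

Lemma tame_stableM b c : tame_stable b -> tame_stable c -> tame_stable (b * c).
Proof. by move=> hb hc d td; rewrite mulrA; apply/hc/hb. Qed.

Lemma tame_stable_scalar (k : R) : 0 <= k -> tame_stable k%:A.
Proof. by move=> k0 c tc; rewrite mulr_algr; exact: tameZ. Qed.

Lemma tame_stable_gen x :
  tame_stable ((T x)%:A + x) /\ tame_stable ((T x)%:A - x).
Proof. by split=> c /(tame_gen x)[]. Qed.

Hypothesis L1 : L 1 = 1.
Hypothesis LT : forall a p q, 0 <= L (((T a)%:A - a) ^+ p * ((T a)%:A + a) ^+ q).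

(** Dividing [T a - a] and [T a + a] by [2 T a] gives [u] and [v] with [u + v = 1] and
    [a = T a (v - u)], so the interval estimates apply. *)
Lemma moment_bounds a : 0 <= L (a ^+ 2) /\ (forall n, L (a ^+ n) <= T a ^+ n).
Proof.
pose s := (T a *+ 2)^-1.
have s0 : 0 < s by rewrite invr_gt0 mulrn_wgt0.
pose u := s *: ((T a)%:A - a); pose v := s *: ((T a)%:A + a).
have uv1 : u + v = 1.
  rewrite -scalerDr addrACA addNr addr0 -scalerDl scalerA -mulr2n.
  by rewrite mulVf ?scale1r// gt_eqF// mulrn_wgt0.
have Luv k l : 0 <= L (u ^+ k * v ^+ l).
  by rewrite !exprZn -scalerAl -scalerAr !linearZ /= !mulr_ge0// exprn_ge0// ltW.
have vuE : a = T a *: (v - u).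
  rewrite -scalerBr scalerA (_ : _ - _ = a *+ 2); last by ring.
  rewrite -scaler_nat scalerA (_ : _ * _ = 1) ?scale1r//.
  by rewrite /s; field; rewrite gt_eqF.
split=> [|n]; rewrite {1}vuE exprZn linearZ /=.
  by rewrite mulr_ge0 ?sqr_ge0// (moment2_ge0 uv1 Luv).
have := moment_le uv1 Luv n; rewrite L1 => vu1.
by rewrite ler_piMr// exprn_ge0// ltW.
Qed.

Lemma tame1 : tame 1.
Proof.
split=> [y|x y]; first by rewrite mul1r; have [] := moment_bounds y.
(* Expanding [0 <= L ((p - t y^2)^2)] gives [2 t L (p y^2) <= L (p^2) + t^2 L (y^4)], where
   [L (p^2) <= t^2]. *)
exists (1 + L ((y ^+ 2) ^+ 2)) => n; rewrite mul1r.
set p := x ^+ _; set t := T x ^+ _.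
have t0 : 0 < t by rewrite exprn_gt0.
have : L (p ^+ 2) <= t ^+ 2 by rewrite -!exprM (moment_bounds x).2.
move: p t t0 => p t t0 Pt.
have : 0 <= L ((p - t *: y ^+ 2) ^+ 2) by have [] := moment_bounds (p - t *: y ^+ 2).
have -> : (p - t *: y ^+ 2) ^+ 2 =
    p ^+ 2 - (t *+ 2) *: (p * y ^+ 2) + t ^+ 2 *: (y ^+ 2) ^+ 2.
  have algE c (z : A) : c *: z = in_alg A c * z by rewrite mulr_algl.
  by rewrite !algE rmorphXn rmorphMn; ring.
rewrite linearD linearB !linearZ /=.
have : 0 <= L ((y ^+ 2) ^+ 2) by have [] := moment_bounds (y ^+ 2).
move: Pt; move: (L ((y ^+ 2) ^+ 2)) (L (p ^+ 2)) (L (p * _)) => Y P Q Pt Y0 H.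
have {}H : 0 <= P + (t *+ 2) * - Q + t ^+ 2 * Y := H.
have : t * Q <= t * ((1 + Y) * t).
  have : 0 <= t ^+ 2 * Y by rewrite mulr_ge0// sqr_ge0.
  have : 0 <= t ^+ 2 by exact: sqr_ge0.
  lra.
by rewrite ler_pM2l.
Qed.

Lemma tame_stable_ge0 b : tame_stable b -> 0 <= L b.
Proof.
by move=> /(_ _ tame1)[/(_ 1)]; rewrite mul1r expr1n mulr1.
Qed.

End tame.

(** * Maximal semimodules and their states *)

Section semimodule.
Variables (S : comNzRingType) (V : lmodType S) (T : set S) (e : V).
Hypotheses (T0 : T 0) (T1 : T 1).
Hypotheses (TD : forall s t, T s -> T t -> T (s + t)).
Hypotheses (TM : forall s t, T s -> T t -> T (s * t)).

Definition semimodule (P : set V) : Prop :=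
  (forall x y, P x -> P y -> P (x + y)) /\
  (forall t x, T t -> P x -> P (t *: x)).

(** The last clause is maximality: for [a] outside [P], the semimodule [P + T a] is strictly larger,
    so it must contain [- e]. *)
Lemma maximal_semimodule (M : set V) : semimodule M -> M e -> ~ M (- e) ->
  exists P : set V, [/\ M `<=` P, semimodule P, ~ P (- e)
    & forall a, ~ P a -> exists p t, [/\ P p, T t & - e = p + t *: a]].
Proof.
move=> sM Me MNe.
(* The conditions bear on nonempty sets only, because Zorn's lemma also asks for the union of the
   empty chain. *)
pose good X := X !=set0 -> [/\ M `<=` X, semimodule X & ~ X (- e)].
have [F FG Ftot|P [gP maxP]] := @Zorn_bigcup V good.
  move=> [z [X FX Xz]].
  have mem Y y : F Y -> Y y -> [/\ M `<=` Y, semimodule Y & ~ Y (- e)].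
    by move=> FY Yy; apply: (FG _ FY); exists y.
  split.
  - by have [MX _ _] := mem _ _ FX Xz; move=> m /MX Xm; exists X.
  - split=> [x y [Y FY Yx] [Z FZ Zy]|t x Tt [Y FY Yx]]; last first.
      by exists Y => //; have [_ [_ YZ] _] := mem _ _ FY Yx; exact: YZ.
    have [YZ|ZY] := Ftot _ _ FY FZ.
      by exists Z => //; have [_ [ZD _] _] := mem _ _ FZ Zy; apply: ZD => //; exact: YZ.
    by exists Y => //; have [_ [YD _] _] := mem _ _ FY Yx; apply: YD => //; exact: ZY.
  - by move=> [Y FY YNe]; have [] := mem _ _ FY YNe.
have [MP sP PNe] : [/\ M `<=` P, semimodule P & ~ P (- e)].
  apply: gP; apply: contrapT => /set0P/negP; rewrite negbK => /eqP P0.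
  apply: (maxP M); last by move=> _; split.
  by rewrite P0; split=> [x []|/(_ _ Me)[]].
exists P; split=> // a Pa.
pose Q := [set x | exists p t, [/\ P p, T t & x = p + t *: a]].
have P0 : P 0 by rewrite -(scale0r e); apply: sP.2 => //; exact: MP.
apply: contrapT => QNe; apply: (maxP Q).
  split; last first.
    by move=> QP; apply/Pa/QP; exists 0, 1; rewrite add0r scale1r.
  by move=> p Pp; exists p, 0; rewrite scale0r addr0.
move=> _; split=> //.
  by move=> m /MP Pm; exists m, 0; rewrite scale0r addr0.
split=> [_ _ [p [t [Pp Tt ->]]] [q [s [Pq Ts ->]]]|s _ Ts [p [t [Pp Tt ->]]]].
  exists (p + q), (t + s); split; [exact: sP.1|exact: TD|].
  by rewrite scalerDl addrACA.
exists (s *: p), (s * t); split; [exact: sP.2|exact: TM|].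
by rewrite scalerDr scalerA.
Qed.

(** If both fail, maximality gives [- e = p + t a = q - s a]. Eliminating [a] yields
    [- t e = s e + s p + t q], which is in [P]; the last hypothesis then puts [t a], hence [- e], in
    [P]. *)
Lemma semimodule_total (P : set V) a : semimodule P -> P e -> ~ P (- e) ->
  (forall a, ~ P a -> exists p t, [/\ P p, T t & - e = p + t *: a]) ->
  (forall t, T t -> P (- (t *: e)) -> P (t *: a)) ->
  P a \/ P (- a).
Proof.
move=> [PD PZ] Pe PNe maxP Pa; apply: contrapT => /not_orP[nPa nPNa].
have [p [t [Pp Tt et]]] := maxP _ nPa.
have [q [s [Pq Ts es]]] := maxP _ nPNa.
apply: PNe; rewrite et; apply: (PD _ _ Pp); apply: Pa => //.
have -> : - (t *: e) = s *: e + (s *: p + t *: q).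
  have sp : s *: p = - (s *: e) - (s * t) *: a.
    by rewrite -scalerN et scalerDr scalerA addrK.
  have tq : t *: q = - (t *: e) + (s * t) *: a.
    by rewrite -scalerN es scalerDr scalerA scalerN mulrC subrK.
  by rewrite sp tq addrACA addNr addr0 addrA subrr add0r.
by apply: (PD _ _ (PZ _ _ Ts Pe)); apply: PD; exact: PZ.
Qed.

End semimodule.

Section cone_value.
Variables (R : realType) (V : lmodType R) (P : set V) (e : V).
Hypotheses (PD : forall x y, P x -> P y -> P (x + y)).
Hypotheses (PZ : forall (c : R) x, 0 <= c -> P x -> P (c *: x)).
Hypotheses (Pe : P e) (PNe : ~ P (- e)).

(* In the preorder with positive cone [P], [c e] is [a] up to infinitesimals. *)
Definition cone_value (a : V) (c : R) : Prop := forall eps, 0 < eps ->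
  P (a - (c - eps) *: e) /\ P ((c + eps) *: e - a).

Lemma cone_scale_unit c : P (c *: e) -> 0 <= c.
Proof.
move=> Pc; rewrite leNgt; apply/negP => c0; apply: PNe.
have := PZ (c := (- c)^-1) _ Pc.
by rewrite scalerA invrN mulNr mulVf ?lt_eqF// scaleN1r; apply; rewrite oppr_ge0 invr_le0 ltW.
Qed.

Lemma cone_value_ge a c r : cone_value a c -> P (a - r *: e) -> r <= c.
Proof.
move=> ac Pa; apply/ler_addgt0Pr => eps eps0.
have := PD Pa (ac _ eps0).2.
by rewrite addrC addrA subrK -scalerBl => /cone_scale_unit; rewrite subr_ge0.
Qed.

Lemma cone_value_le a c r : cone_value a c -> P (r *: e - a) -> c <= r.
Proof.
move=> ac Pa; apply/ler_addgt0Pr => eps eps0; rewrite -lerBlDr.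
have := PD Pa (ac _ eps0).1.
by rewrite addrA subrK -scalerBl => /cone_scale_unit; rewrite subr_ge0.
Qed.

Lemma cone_value_ge0 a c : cone_value a c -> P a -> 0 <= c.
Proof. by move=> ac Pa; apply: (cone_value_ge ac); rewrite scale0r subr0. Qed.

Lemma cone_value_unique a c d : cone_value a c -> cone_value a d -> c = d.
Proof.
move=> ac ad; apply/eqP; rewrite eq_le; apply/andP; split.
  by apply/ler_addgt0Pr => eps eps0; apply: (cone_value_le ac); have [] := ad _ eps0.
by apply/ler_addgt0Pr => eps eps0; apply: (cone_value_le ad); have [] := ac _ eps0.
Qed.

Lemma cone_valueD a b c d :
  cone_value a c -> cone_value b d -> cone_value (a + b) (c + d).
Proof.
move=> ac bd eps eps0; have eps2 : 0 < eps / 2 by rewrite divr_gt0.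
have [a1 a2] := ac _ eps2; have [b1 b2] := bd _ eps2; split.
  have := PD a1 b1; rewrite addrACA -opprD -scalerDl; congr (P (_ - _ *: _)).
  by field.
have := PD a2 b2; rewrite addrACA -opprD -scalerDl; congr (P (_ *: _ - _)).
by field.
Qed.

Lemma cone_valueN a c : cone_value a c -> cone_value (- a) (- c).
Proof.
move=> ac eps eps0; have [a1 a2] := ac _ eps0; split.
  move: a2; congr (P _).
  by rewrite -[- c - eps]opprD scaleNr opprK addrC.
by move: a1; congr (P _); rewrite opprK addrC -scaleNr opprB [eps - c]addrC.
Qed.

Lemma cone_valueZ (k : R) a c : cone_value a c -> cone_value (k *: a) (k * c).
Proof.
move=> ac.
have pos (m : R) b d : 0 <= m -> cone_value b d -> cone_value (m *: b) (m * d).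
  move=> m0 bd eps eps0.
  (* The precision [eps / (m + 1)] also covers [m = 0]; after scaling by [m] exactly [eps / (m + 1)]
     is left for the slack to fill. *)
  have m1 : 0 < m + 1 by rewrite ltr_wpDl.
  have [b1 b2] := bd (eps / (m + 1)) (divr_gt0 eps0 m1).
  have Pslack : P ((eps / (m + 1)) *: e) by apply: PZ => //; rewrite ltW// divr_gt0.
  split.
    have := PD (PZ m0 b1) Pslack; congr (P _).
    rewrite scalerBr scalerA -addrA -scaleNr -scalerDl -[in RHS]scaleNr.
    by congr (_ + _ *: _); field; rewrite gt_eqF.
  have := PD (PZ m0 b2) Pslack; congr (P _).
  rewrite scalerBr scalerA addrAC -scalerDl.
  by congr (_ *: _ - _); field; rewrite gt_eqF.
have [k0|k0] := leP 0 k; first exact: pos.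
by rewrite -[k]opprK scaleNr mulNr; apply/cone_valueN/pos; rewrite // oppr_ge0 ltW.
Qed.

Lemma cone_value_unit : cone_value e 1.
Proof.
move=> eps eps0; split.
  rewrite -{1}[e]scale1r -scalerBl; apply: PZ => //.
  by rewrite opprB addrC subrK ltW.
rewrite -{2}[e]scale1r -scalerBl; apply: PZ => //.
by rewrite addrC addKr ltW.
Qed.

Lemma cone_value_exists a :
  (exists r, P (r *: e - a) /\ P (r *: e + a)) ->
  (forall r, P (a - r *: e) \/ P (r *: e - a)) ->
  exists c, cone_value a c.
Proof.
move=> [n [na1 na2]] tot.
(* The value is the Dedekind cut of the [r] with [r e] below [a]. The bound by multiples of [e]
   makes the cut finite, and totality at [sup B + eps] gives the upper estimate. *)
pose B := [set r | P (a - r *: e)].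
have supB : has_sup B.
  split; first by exists (- n); rewrite /B /= scaleNr opprK addrC.
  exists n => r Br; have := PD Br na1.
  by rewrite addrC addrA subrK -scalerBl => /cone_scale_unit; rewrite subr_ge0.
exists (sup B) => eps eps0; split.
  have [r Br rs] := sup_adherent eps0 supB.
  have := PD Br (PZ _ Pe : P ((r - (sup B - eps)) *: e)).
  rewrite scalerBl addrA subrK; apply.
  by rewrite subr_ge0 ltW.
have [Pa|//] := tot (sup B + eps).
have := sup_upper_bound supB Pa.
by rewrite leNgt ltrDl eps0.
Qed.

End cone_value.

(** * Representation theorem and positive extension *)

Section archimedean_semiring.
Variables (R : realType) (A : comAlgType R) (Q : set A).
Hypotheses (QD : forall a b, Q a -> Q b -> Q (a + b)).
Hypotheses (QM : forall a b, Q a -> Q b -> Q (a * b)).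
Hypotheses (Qscalar : forall c : R, 0 <= c -> Q c%:A).
Hypotheses (Qarch : forall a, exists c : R, Q (c%:A - a)).

Let Q0 : Q 0. Proof. by have := Qscalar (lexx 0); rewrite scale0r. Qed.

Let Q1 : Q 1. Proof. by have := Qscalar ler01; rewrite scale1r. Qed.

Let Qarch_ge0 a : exists2 c : R, 0 <= c & Q (c%:A - a).
Proof.
have [c Qc] := Qarch a; exists `|c| => //.
have := QD Qc (Qscalar (_ : 0 <= `|c| - c)); rewrite subr_ge0 ler_norm => /(_ isT).
by congr Q; rewrite scalerBl; ring.
Qed.

(** A maximal proper [Q]-module [P] above [M] is a total cone with order unit 1, so each element has
    a [cone_value]; stability of [P] under [Q] makes this value multiplicative. *)
Lemma arch_semiring_character (M : set A) :
  semimodule (V := A^o) Q M -> M 1 -> ~ M (- 1) ->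
  exists alpha : A -> R,
    [/\ characters A alpha, forall b, Q b -> 0 <= alpha b
      & forall b, M b -> 0 <= alpha b].
Proof.
move=> sM M1 MN1.
have [P [MP sP PN1 maxP]] := maximal_semimodule (V := A^o) Q0 Q1 QD QM sM M1 MN1.
have P1 : P 1 := MP _ M1.
have [PD PQ] := sP.
have QP b : Q b -> P b by move=> /PQ/(_ P1); rewrite /GRing.scale/= mulr1.
have PZ (c : R) x : 0 <= c -> P x -> P (c *: x).
  by move=> c0 Px; rewrite -mulr_algl; apply: PQ => //; exact: Qscalar.
have tot a : P a \/ P (- a).
  apply: (semimodule_total (V := A^o) sP P1 PN1 maxP) => t Qt PNt.
  (* With [c - a] in [Q] and [- t] in [P], use [t a = (c - a) (- t) + c t]. *)
  have [c c0 Qc] := Qarch_ge0 a.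
  have := PD _ _ (PQ _ _ Qc PNt) (QP _ (QM (Qscalar c0) Qt)).
  by congr P; rewrite /GRing.scale/=; ring.
pose near := cone_value P (1 : A).
pose alpha a := xget 0 [set c | near a c].
have alphaP a : near a (alpha a).
  have [c nc] : exists c, near a c; last exact: (xgetI 0 nc).
  apply: cone_value_exists => //.
    have [c c0 Qc] := Qarch_ge0 a; have [d d0 Qd] := Qarch_ge0 (- a).
    exists (c + d); rewrite scalerDl; split; apply: QP.
      by rewrite addrAC; apply: QD => //; exact: Qscalar.
    by rewrite -addrA; apply: QD; [exact: Qscalar|rewrite -[X in _ + X]opprK].
  by move=> r; have := tot (a - r%:A); rewrite opprB.
have alphaE a c : near a c -> alpha a = c.
  by apply: (cone_value_unique PD PZ PN1); exact: alphaP.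
have alpha_ge0 a : P a -> 0 <= alpha a.
  exact: (cone_value_ge0 PD PZ PN1 (alphaP a)).
have alphaD a b : alpha (a + b) = alpha a + alpha b.
  by apply: alphaE; exact: (cone_valueD PD (alphaP a) (alphaP b)).
have alphaZ c a : alpha (c *: a) = c * alpha a.
  by apply: alphaE; exact: (cone_valueZ PD PZ P1 c (alphaP a)).
have alpha1 : alpha 1 = 1 by apply: alphaE; exact: cone_value_unit.
have alphaN a : alpha (- a) = - alpha a by rewrite -scaleN1r alphaZ mulN1r.
have alphaQM t x : Q t -> alpha (t * x) = alpha t * alpha x.
  move=> Qt; have t0 := alpha_ge0 _ (QP _ Qt).
  (* Multiplying [y - (alpha y - d)], which is in [P], by [t] gives this up to the error
     [d * alpha t < eps]. The reverse inequality is the case [y = - x]. *)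
  have ge y : alpha t * alpha y <= alpha (t * y).
    apply/ler_addgt0Pr => eps eps0.
    pose d := eps / (alpha t + 1).
    have t1 : 0 < alpha t + 1 by rewrite ltr_wpDl.
    have d0 : 0 < d by rewrite divr_gt0.
    have := alpha_ge0 _ (PQ _ _ Qt (alphaP y d d0).1).
    rewrite /GRing.scale/= mulrBr alphaD alphaN mulr_algr alphaZ.
    have : d * (alpha t + 1) = eps by rewrite /d mulfVK// gt_eqF.
    nra.
  apply/eqP; rewrite eq_le ge andbT.
  by have := ge (- x); rewrite mulrN !alphaN mulrN lerN2.
exists alpha; split.
- apply/charactersP; split=> [//|a b|c a b]; last by rewrite alphaD alphaZ.
  (* Writing [a = (c + a) - c] with [c + a] in [Q] reduces to a left factor in [Q]. *)
  have [c c0 Qc] := Qarch_ge0 (- a).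
  have -> : a * b = (c%:A - - a) * b - c *: b.
    by rewrite opprK -[c *: b]mulr_algl; ring.
  rewrite alphaD alphaN alphaQM// alphaD alphaN alphaZ alphaN alphaZ alpha1.
  ring.
- by move=> b /QP; exact: alpha_ge0.
- by move=> b /MP; exact: alpha_ge0.
Qed.

(** If [-1] is not in [Q - f Q], some character is nonnegative on [Q] and on [- f], against the
    positivity of [f]. Otherwise [f p = 1 + q] with [p], [q] in [Q]; starting from [f + r] in [Q]
    with [r] large, this identity lowers [r] by a fixed [1/k] at a time, down to 0. *)
Lemma arch_positivstellensatz f :
  (forall alpha : A -> R, characters A alpha -> (forall b, Q b -> 0 <= alpha b) ->
     0 < alpha f) -> Q f.
Proof.
move=> f_gt0.
pose M := [set x | exists p q, [/\ Q p, Q q & x = p - f * q]].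
have [[q [p [Qq Qp fpE]]]|MN1] := pselect (M (- 1)); last first.
  have sM : semimodule (V := A^o) Q M.
    split=> [_ _ [p [q [Qp Qq ->]]] [s [t [Qs Qt ->]]]|t _ Qt [p [q [Qp Qq ->]]]].
      by exists (p + s), (q + t); split; [exact: QD|exact: QD|rewrite mulrDr; ring].
    by exists (t * p), (t * q); split; [exact: QM|exact: QM|rewrite /GRing.scale/=; ring].
  have M1 : M 1 by exists 1, 0; split => //; rewrite mulr0 subr0.
  have [alpha [chi alphaQ alphaM]] := arch_semiring_character sM M1 MN1.
  have := f_gt0 _ chi alphaQ.
  have /alphaM : M (- f) by exists 0, 1; split => //; rewrite mulr1 add0r.
  have /charactersP[_ _ lin] := chi.
  have alpha0 : alpha 0 = 0.
    by have := lin (-1) 0 0; rewrite scaleN1r oppr0 addr0 mulN1r addNr.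
  by have := lin (-1) f 0; rewrite scaleN1r addr0 alpha0 addr0 mulN1r => ->; lra.
have [c c0 Qc] := Qarch_ge0 p.
pose k := c + 1; have k0 : 0 < k by rewrite ltr_wpDl.
have Qkp : Q (k%:A - p).
  by have := QD Qc Q1; congr Q; rewrite /k scalerDl scale1r; ring.
(* [k (f + r - 1/k) = (k - p) (f + r) + (p f - 1) + r p] *)
have step r : 0 <= r -> Q (f + r%:A) -> Q (f + (r - k^-1)%:A).
  move=> r0 Qr.
  have := QD (QD (QM Qkp Qr) Qq) (QM (Qscalar r0) Qp).
  have k1 : 0 <= k^-1 by rewrite invr_ge0 ltW.
  move=> /(QM (Qscalar k1)); congr Q.
  have kk : k%:A * (k^-1)%:A = 1 :> A.
    by rewrite mulr_algl scalerA mulfV ?scale1r// gt_eqF.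
  have qE : q = f * p - 1 by rewrite fpE; ring.
  rewrite qE scalerBl.
  have -> : (k^-1)%:A * ((k%:A - p) * (f + r%:A) + (f * p - 1) + r%:A * p) =
    (k%:A * (k^-1)%:A) * (f + r%:A) - (k^-1)%:A by ring.
  by rewrite kk; ring.
have desc n : Q (f + (n%:R / k)%:A) -> Q f.
  elim: n => [|n IH]; first by rewrite mul0r scale0r addr0.
  move=> /step; rewrite divr_ge0 ?ltW// => /(_ isT) H; apply: IH.
  by move: H; congr (Q (_ + _ *: _)); rewrite -natr1; field; rewrite gt_eqF.
have [d d0 Qd] := Qarch_ge0 (- f).
apply: (desc (Num.truncn (d * k)).+1).
have dk : 0 <= (Num.truncn (d * k)).+1%:R / k - d.
  by rewrite subr_ge0 ler_pdivlMr// ltW// truncnS_gt.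
by have := QD Qd (Qscalar dk); congr Q; rewrite scalerBl; ring.
Qed.

End archimedean_semiring.

Definition norm_bounded (R : realType) (K : Type) (f : K -> R) : Prop :=
  exists r, forall x, `|f x| <= r.

Lemma norm_bounded_lin (R : realType) (T : Type) (c : R) (f g : T -> R) :
  norm_bounded f -> norm_bounded g -> norm_bounded (c *: f + g).
Proof.
move=> [r fr] [s gs]; exists (`|c| * r + s) => x.
rewrite (le_trans (ler_normD _ _))// lerD// normrM.
by rewrite ler_wpM2l.
Qed.

Lemma norm_bounded_indic (R : realType) (T : Type) (B : set T) : norm_bounded (\1_B : T -> R).
Proof. by exists 1 => x; rewrite indicE; case: (x \in B); rewrite ?normr1 ?normr0. Qed.

Lemma norm_bounded_cst (R : realType) (T : Type) (c : R) : norm_bounded (cst c : T -> R).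
Proof. by exists `|c|. Qed.

(* Hahn-Banach: [Lambda] extends [L] from the functions [ev a] to all bounded
   functions; being an integral against a finitely additive measure, it has no
   meaning on unbounded functions. *)
Lemma positive_extension (R : realType) (K : Type) (V : lmodType R)
    (L : {scalar V}) (ev : {linear V -> (K -> R)}) (u : V) :
  L u = 1 -> ev u = cst 1 ->
  (forall a, (forall x, 0 <= ev a x) -> 0 <= L a) ->
  exists Lambda : (K -> R) -> R,
    [/\ forall a, Lambda (ev a) = L a,
        forall f : K -> R, (forall x, 0 <= f x) -> norm_bounded f -> 0 <= Lambda f &
        forall (c : R) (f g : K -> R), norm_bounded f -> norm_bounded g ->
          Lambda (c *: f + g) = c * Lambda f + Lambda g].
Proof.
move=> Lu evu L_ge0.
pose e : K -> R := cst 1.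
pose T := [set c : R | 0 <= c].
(* Besides the nonnegative functions, this cone contains [ev a] whenever [0 <= L a], which forces
   the extension to agree with [L]. *)
pose M := [set f : K -> R | exists a, 0 <= L a /\ forall x, ev a x <= f x].
have T0 : T 0 by rewrite /T /=.
have T1 : T 1 by rewrite /T /= ler01.
have TD s t : T s -> T t -> T (s + t) by exact: addr_ge0.
have TM s t : T s -> T t -> T (s * t) by exact: mulr_ge0.
have sM : semimodule T M.
  split=> [f g [a [a0 af]] [b [b0 bg]]|t f t0 [a [a0 af]]].
    exists (a + b); split; first by rewrite linearD addr_ge0.
    by move=> x; rewrite linearD; exact: lerD.
  exists (t *: a); split; first by rewrite linearZ mulr_ge0.
  by move=> x; rewrite linearZ; exact: ler_wpM2l.
have MP f : (forall x, 0 <= f x) -> M f.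
  by move=> f0; exists 0; split=> [|x]; rewrite linear0.
have Me : M e by apply: MP => x; exact: ler01.
have MNe : ~ M (- e).
  move=> [a [a0 ae]].
  have : 0 <= L (- a - u).
    apply: L_ge0 => x; rewrite linearB linearN evu.
    by have := ae x; rewrite -subr_ge0 addrC.
  by rewrite linearB linearN Lu; lra.
have [P [MsP sP PNe maxP]] := maximal_semimodule T0 T1 TD TM sM Me MNe.
have [PD PZ] := sP.
have Pe : P e by exact: MsP.
have {}PZ (c : R) f : 0 <= c -> P f -> P (c *: f) by exact: PZ.
have tot a : P a \/ P (- a).
  (* For [t >= 0], [- t e] lies in [P] only if [t = 0]. *)
  apply: (semimodule_total sP Pe PNe maxP) => t Tt.
  rewrite -scalerN => Pt; have [t0|t0] := ltP 0 t.
    exfalso; apply: PNe; have := PZ t^-1 _ _ Pt.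
    by rewrite scalerA mulVf ?gt_eqF// scale1r; apply; rewrite invr_ge0 ltW.
  have -> : t = 0 by apply/eqP; rewrite eq_le t0.
  by rewrite scale0r; apply/MsP/MP.
pose near := cone_value P e.
pose Lambda f := xget 0 [set c | near f c].
have LambdaE f c : near f c -> Lambda f = c.
  by move=> fc; apply: (cone_value_unique PD PZ PNe (xgetI 0 fc) fc).
have LambdaP f : norm_bounded f -> near f (Lambda f).
  move=> bf.
  have [c nc] : exists c, near f c; last exact: (xgetI 0 nc).
  apply: cone_value_exists => //.
    have [r fr] := bf.
    exists r; split; apply/MsP/MP => x; have := fr x;
      rewrite ler_norml => /andP[]; rewrite /e !fctE /= [r%:A]mulr1; lra.
  by move=> r; have := tot (f - r *: e); rewrite opprB.
exists Lambda; split.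
- move=> a; apply: LambdaE => eps eps0.
  (* Used for [a - L a u] and for its negative: [L] vanishes on both, so [ev a] and [L a e] differ
     by elements of the cone in either direction. *)
  have near0 b : L b = 0 -> P (ev b + eps *: e).
    move=> Lb; apply/PD/(PZ _ _ (ltW eps0) Pe)/MsP.
    by exists b; rewrite Lb; split.
  have ev_scale c : ev (c *: u) = c *: e by rewrite linearZ evu.
  split.
    have := near0 (a - L a *: u); rewrite linearB linearZ /= Lu mulr1 subrr.
    move=> /(_ erefl); congr P.
    by rewrite linearB ev_scale scalerBl opprB addrA addrAC.
  have := near0 (L a *: u - a); rewrite linearB linearZ /= Lu mulr1 subrr.
  move=> /(_ erefl); congr P.
  by rewrite linearB ev_scale scalerDl addrAC.
- move=> f f0 bf; apply: (cone_value_ge0 PD PZ PNe (LambdaP f bf)).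
  exact/MsP/MP.
- move=> c f g bf bg; apply: LambdaE; apply: cone_valueD => //; last exact: LambdaP.
  by apply: cone_valueZ => //; exact: LambdaP.
Qed.

(** * Radon measures from finitely additive ones *)

Section content_regularization.
Variables (R : realType) (X : topologicalType) (x0 : X) (nu : set X -> R).
Hypotheses (hX : hausdorff_space X) (cX : compact [set: X]).
Hypotheses (nu_ge0 : forall B, 0 <= nu B).
Hypotheses (nuU : forall B C, B `&` C = set0 -> nu (B `|` C) = nu B + nu C).

Let nu0 : nu set0 = 0.
Proof.
have := nuU (set0I (@set0 X)); rewrite setU0; lra.
Qed.

Let nu_le B C : B `<=` C -> nu B <= nu C.
Proof.
move=> BC; rewrite -(setDUK BC) nuU ?lerDl//.
by apply/seteqP; split=> [x [Bx []]|].
Qed.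

Let nuU_le B C : nu (B `|` C) <= nu B + nu C.
Proof.
have -> : B `|` C = B `|` (C `\` B).
  apply/seteqP; split=> x [Bx|]; [by left| |by left|by move=> [Cx _]; right].
  by move=> Cx; have [Bx|nBx] := pselect (B x); [left|right].
rewrite nuU; first by rewrite lerD2l nu_le// => x [].
by apply/seteqP; split=> [x [Bx []]|].
Qed.

Local Open Scope ereal_scope.

Definition inner_content (U : set X) : \bar R :=
  ereal_sup [set (nu C)%:E | C in [set C | closed C /\ C `<=` U]].

Definition outer_content (E : set X) : \bar R :=
  ereal_inf [set inner_content U | U in [set U | open U /\ E `<=` U]].

Lemma inner_content_ge C U : closed C -> C `<=` U -> (nu C)%:E <= inner_content U.
Proof. by move=> cC CU; apply: ereal_sup_ubound; exists C. Qed.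

Lemma inner_content_ge0 U : 0 <= inner_content U.
Proof.
have -> : 0 = (nu set0)%:E by rewrite nu0.
by apply: inner_content_ge => //; exact: closed0.
Qed.

Lemma inner_content_le U V : U `<=` V -> inner_content U <= inner_content V.
Proof.
move=> UV; apply: ge_ereal_sup => _ [C [cC CU] <-].
by apply: inner_content_ge => //; exact: subset_trans UV.
Qed.

Lemma inner_content_le_nu U : inner_content U <= (nu U)%:E.
Proof.
by apply: ge_ereal_sup => _ [C [cC CU] <-]; rewrite lee_fin nu_le.
Qed.

Lemma inner_content_fin U : inner_content U \is a fin_num.
Proof.
by rewrite ge0_fin_numE ?inner_content_ge0// (le_lt_trans (inner_content_le_nu _))// ltry.
Qed.

(** Normality separates the disjoint closed sets [C \ V] and [C \ U] by open sets [U'] and [V'].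
    Then [C] is the union of the closed sets [C \ V'], inside [U], and [C \ U'], inside [V]. *)
Lemma inner_contentU U V : open U -> open V ->
  inner_content (U `|` V) <= inner_content U + inner_content V.
Proof.
move=> oU oV; apply: ge_ereal_sup => _ [C [cC CUV] <-].
have nX := compact_normal hX cX.
have [U' [V' [oU' oV' CU' CV' UV']]] : exists U' V', [/\ open U', open V',
    C `\` V `<=` U', C `\` U `<=` V' & U' `&` V' = set0].
  apply: ((@normal_openP R X).1 nX).
  - by apply: closedI => //; exact: open_closedC.
  - by apply: closedI => //; exact: open_closedC.
  - by apply/seteqP; split=> [x [[/CUV[Ux|Vx] nVx] [_ nUx]]|//].
have cE : C = (C `\` V') `|` (C `\` U').
  by rewrite -setDIr setIC UV' setD0.
rewrite {1}cE (le_trans (_ : _ <= (nu (C `\` V') + nu (C `\` U'))%:E)) ?lee_fin//.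
rewrite EFinD leeD// inner_content_ge//.
- by apply: closedI => //; exact: open_closedC.
- by move=> x [Cx nVx]; have [//|Vx] := pselect (U x); exfalso; apply/nVx/CV'.
- by apply: closedI => //; exact: open_closedC.
- by move=> x [Cx nVx]; have [//|Vx] := pselect (V x); exfalso; apply/nVx/CU'.
Qed.

Lemma inner_content_bigcup (U : (set X)^nat) : (forall i, open (U i)) ->
  inner_content (\bigcup_i U i) <= \sum_(i <oo) inner_content (U i).
Proof.
move=> oU; apply: ge_ereal_sup => _ [C [cC CU] <-].
have cptC : compact C := subclosed_compact cC cX (@subsetT _ C).
pose pX : ptopologicalType := HB.pack (X : Type) (isPointed.Build X x0) X.
have : cover_compact (C : set pX) by rewrite -compact_cover.
move=> /(_ nat setT U (fun i _ => oU i) CU)[D _ CD].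
pose n := (\max_(i <- finmap.enum_fset D) i).+1.
have {}CD : C `<=` \big[setU/set0]_(i < n) U i.
  move=> x /CD[i /= iD Uix]; rewrite -bigcup_mkord; exists i => //=.
  by rewrite /n ltnS; apply: leq_bigmax_seq.
have Un : inner_content (\big[setU/set0]_(i < n) U i) <= \sum_(i < n) inner_content (U i).
  elim: n {CD} => [|n IH].
    by rewrite !big_ord0 (le_trans (inner_content_le_nu _))// nu0.
  rewrite !big_ord_recr/=; apply: le_trans (inner_contentU _ _) _ => //.
    by rewrite -bigcup_mkord; exact: bigcup_open.
  by rewrite leeD2r.
rewrite (le_trans (inner_content_ge cC CD))// (le_trans Un)//.
rewrite -(big_mkord xpredT (fun i => inner_content (U i))).
by apply: nneseries_lim_ge => i _ _; exact: inner_content_ge0.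
Qed.

Lemma outer_content_le_inner U E : open U -> E `<=` U ->
  outer_content E <= inner_content U.
Proof. by move=> oU EU; apply: ereal_inf_lbound; exists U. Qed.

Lemma outer_content_open U : open U -> outer_content U = inner_content U.
Proof.
move=> oU; apply/eqP; rewrite eq_le outer_content_le_inner//=.
by apply: le_ereal_inf_tmp => _ [V [oV UV] <-]; exact: inner_content_le.
Qed.

Lemma outer_content_ge0 E : 0 <= outer_content E.
Proof.
by apply: le_ereal_inf_tmp => _ [V [oV UV] <-]; exact: inner_content_ge0.
Qed.

Lemma outer_contentT : outer_content [set: X] = (nu [set: X])%:E.
Proof.
rewrite outer_content_open; last exact: openT.
apply/eqP; rewrite eq_le inner_content_le_nu/=.
by apply: inner_content_ge => //; exact: closedT.
Qed.

Lemma outer_content_mono E F : E `<=` F -> outer_content E <= outer_content F.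
Proof.
move=> EF; apply: le_ereal_inf_tmp => _ [V [oV FV] <-].
by apply: outer_content_le_inner => //; exact: subset_trans FV.
Qed.

Lemma outer_content_fin E : outer_content E \is a fin_num.
Proof.
rewrite ge0_fin_numE ?outer_content_ge0//.
by rewrite (le_lt_trans (outer_content_mono (@subsetT _ E)))// outer_contentT ltry.
Qed.

Lemma nu_le_outer C : closed C -> (nu C)%:E <= outer_content C.
Proof.
move=> cC; apply: le_ereal_inf_tmp => _ [V [oV CV] <-].
exact: inner_content_ge.
Qed.

Lemma outer_content_adherent E (eps : R) : (0 < eps)%R ->
  exists U, [/\ open U, E `<=` U & inner_content U <= outer_content E + eps%:E].
Proof.
move=> eps0; have [_ [U [oU EU] <-] Ueps] := lb_ereal_inf_adherent eps0 (outer_content_fin E).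
by exists U; split => //; exact: ltW.
Qed.

Lemma outer_content0 : outer_content set0 = 0.
Proof.
rewrite outer_content_open; last exact: open0.
apply/eqP; rewrite eq_le inner_content_ge0 andbT.
by rewrite (le_trans (inner_content_le_nu _))// nu0.
Qed.

Lemma outer_content_sigma_subadditive : sigma_subadditive outer_content.
Proof.
move=> F; apply/lee_addgt0Pr => eps eps0.
rewrite (le_trans _ (epsilon_trick _ _ (ltW eps0)))//; last first.
  by move=> n; exact: outer_content_ge0.
have [U PU] : {U : (set X)^nat & forall n, [/\ open (U n), F n `<=` U n &
    inner_content (U n) <= outer_content (F n) + (eps / (2 ^ n.+1)%:R)%:E]}.
  apply: (@choice _ _ (fun n U => [/\ open U, F n `<=` U & inner_content U <= _])) => n.
  by apply: outer_content_adherent; rewrite divr_gt0.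
have oU n : open (U n) by have [] := PU n.
apply: (@le_trans _ _ (inner_content (\bigcup_n U n))).
  apply: outer_content_le_inner; first exact: bigcup_open.
  by apply: subset_bigcup => n _; have [] := PU n.
apply: le_trans (inner_content_bigcup oU) _.
by apply: lee_nneseries => n _; [move=> _; exact: inner_content_ge0|have [] := PU n].
Qed.

Let Y := borel_type x0.

Let om : {outer_measure set Y -> \bar R} :=
  HB.pack (outer_content : set Y -> \bar R)
    (isOuterMeasure.Build R Y outer_content outer_content0 outer_content_ge0
      outer_content_mono outer_content_sigma_subadditive).

(** Choose nearly optimal sets in turn: [V] open around [E], [C] closed in [V & U], then [D] closed
    in [V \ C], an open set containing [E \ U]. As [C] and [D] are disjoint in [V], [nu C + nu D] is
    at most the content of [V]; the three errors add up to [eps]. *)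
Lemma open_caratheodory U : open U -> caratheodory_measurable outer_content U.
Proof.
move=> oU; apply: (@le_caratheodory_measurable R Y om) => E.
apply/lee_addgt0Pr => eps eps0.
have eps3 : (0 < eps / 3)%R by rewrite divr_gt0.
have [V [oV EV VE]] := outer_content_adherent E eps3.
have [_ [C [cC CVU] <-] Ceps] :=
  ub_ereal_sup_adherent eps3 (inner_content_fin (V `&` U)).
have oVC : open (V `\` C) by rewrite setDE; apply: openI => //; exact: closed_openC.
have [_ [D [cD DVC] <-] Deps] :=
  ub_ereal_sup_adherent eps3 (inner_content_fin (V `\` C)).
have h1 : outer_content (E `&` U) <= (nu C + eps / 3)%:E.
  rewrite EFinD; apply: le_trans (outer_content_le_inner (openI oV oU) _) _.
    exact: setSI.
  by rewrite -leeBlDr//; exact: ltW.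
have h2 : outer_content (E `&` ~` U) <= (nu D + eps / 3)%:E.
  rewrite EFinD; apply: le_trans (outer_content_le_inner oVC _) _.
    by move=> x [Ex nUx]; split; [exact: EV|move=> /CVU[]].
  by rewrite -leeBlDr//; exact: ltW.
have h3 : (nu C + nu D)%:E <= outer_content E + (eps / 3)%:E.
  rewrite -nuU; last by apply/seteqP; split=> [x [Cx /DVC[]]|].
  apply: le_trans VE; apply: inner_content_ge; first exact: closedU.
  by move=> x [/CVU[]|/DVC[]].
apply: le_trans (leeD h1 h2) _.
have -> : eps%:E = (eps / 3)%:E + (eps / 3 + eps / 3)%:E.
  by rewrite -EFinD; congr EFin; field.
rewrite addeA; apply: le_trans (leeD2r _ h3).
by rewrite -!EFinD lee_fin; lra.
Qed.

Lemma measurable_caratheodory (B : set Y) : measurable B ->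
  caratheodory_measurable outer_content B.
Proof.
apply: (smallest_sub (G := @open X)); last exact: open_caratheodory.
split=> [|E cE|F cF].
- exact: (@caratheodory_measurable_set0 R Y om).
- by rewrite setTD; exact: (@caratheodory_measurable_setC R Y om).
- exact: (@caratheodory_measurable_bigcup R Y om).
Qed.

Lemma outer_content_semi_sigma_additive :
  semi_sigma_additive (outer_content : set Y -> \bar R).
Proof.
move=> F mF tF mUF.
apply: (@caratheodory_measure_sigma_additive R Y om) => // [i|];
  exact: measurable_caratheodory.
Qed.

Lemma outer_contentC (B : set Y) : measurable B ->
  outer_content B + outer_content (~` B) = (nu setT)%:E.
Proof.
by move=> /measurable_caratheodory/(_ setT); rewrite !setTI outer_contentT.
Qed.

Lemma content_regularization : exists mu : {measure set Y -> \bar R},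
  [/\ radon_measure mu, mu setT = (nu setT)%:E &
      forall C, closed C -> (nu C)%:E <= mu C].
Proof.
pose mu : {measure set Y -> \bar R} :=
  HB.pack (outer_content : set Y -> \bar R)
    (isMeasure.Build _ _ _ (outer_content : set Y -> \bar R) outer_content0
      outer_content_ge0 outer_content_semi_sigma_additive).
have muE : mu = outer_content :> (set Y -> \bar R) by [].
exists mu; split; [|exact: outer_contentT|exact: nu_le_outer].
split=> [C _|B mB]; first by rewrite -ge0_fin_numE ?outer_content_fin.
apply/eqP; rewrite eq_le; apply/andP; split; last first.
  by apply: ge_ereal_sup => _ [C [_ CB] <-]; exact: outer_content_mono.
apply/lee_addgt0Pr => eps eps0.
(* Inner regularity of [B] is outer regularity of its complement: the complement of [U] is compact
   in [B], and additivity turns the excess of [U] over the complement of [B] into the defect of the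
   compact set. *)
have [U [oU BU Ueps]] := outer_content_adherent (~` B) eps0.
have cU : closed (~` U) by exact: open_closedC.
have UB : ~` U `<=` B by rewrite -[B]setCK; exact: subsetC.
apply: (@le_trans _ _ (outer_content (~` U) + eps%:E)); last first.
  rewrite leeD2r//; apply: ereal_sup_ubound; exists (~` U) => //; split=> //.
  exact: subclosed_compact cU cX (@subsetT _ _).
have mU : measurable (U : set Y) by exact: sub_sigma_algebra.
have := outer_contentC mB; rewrite -(outer_contentC mU).
move: Ueps; rewrite -outer_content_open// muE.
have := outer_content_fin B; have := outer_content_fin (~` B).
have := outer_content_fin U; have := outer_content_fin (~` U).
case: (outer_content B) => // b; case: (outer_content (~` B)) => // b'.
case: (outer_content U) => // u; case: (outer_content (~` U)) => // u'.
move=> _ _ _ _; rewrite -!EFinD !lee_fin => h [h']; lra.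
Qed.

End content_regularization.

(** * Comparison of integrals *)

Section layers.
Variables (R : realType) (delta : R).
Hypothesis delta_gt0 : 0 < delta.

(** For [t >= 0] this is [delta * min (n, floor (t / delta))]. *)
Let layers (n : nat) (t : R) : R :=
  \sum_(k < n) delta * (delta * k.+1%:R <= t)%R%:R.

Lemma layers_approx n t : 0 <= t -> layers n t <= t /\
  (t <= delta * n.+1%:R -> t <= layers n t + delta).
Proof.
move=> t0.
(* The middle clause strengthens the induction: once a threshold is reached, all earlier layers are
   full. *)
suff : [/\ layers n t <= t, delta * n%:R <= t -> layers n t = delta * n%:R
    & t <= delta * n.+1%:R -> t <= layers n t + delta] by case.
elim: n => [|n [IH1 IH2 IH3]].
  by rewrite /layers big_ord0 mulr0 mulr1 add0r.
have -> : layers n.+1 t = layers n t + delta * (delta * n.+1%:R <= t)%R%:R.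
  by rewrite /layers big_ord_recr.
have [nt|nt] := leP (delta * n.+1%:R) t; last first.
  rewrite mulr0 addr0; split => //.
  by move=> _; apply/IH3/ltW.
rewrite IH2; last by rewrite (le_trans _ nt)// ler_pM2l// ler_nat.
have -> : delta * n%:R + delta * 1 = delta * n.+1%:R.
  by rewrite -natr1 mulrDr.
by split=> //; rewrite -[n.+2%:R]natr1 mulrDr mulr1.
Qed.

End layers.

Section integral_ge.
Variables (R : realType) (d : measure_display) (Y : measurableType d).
Variables (mu : {measure set Y -> \bar R}) (Lambda : (Y -> R) -> R).
Hypothesis Lambda_ge0 : forall f : Y -> R,
  (forall x, 0 <= f x) -> norm_bounded f -> 0 <= Lambda f.
Hypothesis Lambda_lin : forall (c : R) (f g : Y -> R),
  norm_bounded f -> norm_bounded g ->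
  Lambda (c *: f + g) = c * Lambda f + Lambda g.
Hypothesis Lambda1 : Lambda (cst 1) = 1.

Lemma Lambda_le f g : norm_bounded f -> norm_bounded g ->
  (forall x, f x <= g x) -> Lambda f <= Lambda g.
Proof.
move=> bf bg fg; rewrite -subr_ge0 addrC -mulN1r -Lambda_lin//.
apply: Lambda_ge0; last exact: norm_bounded_lin.
by move=> x; rewrite !fctE scaleN1r addrC subr_ge0.
Qed.

Lemma integral_ge_positive_functional (f : Y -> R) (M : R) :
  measurable_fun setT f -> (forall x, 0 <= f x <= M) ->
  (forall r, ((Lambda \1_[set x | (r <= f x)%R])%:E <= mu [set x | (r <= f x)%R])%E) ->
  ((Lambda f)%:E <= \int[mu]_x (f x)%:E)%E.
Proof.
move=> mf f0M Lmu.
have f0 x : 0 <= f x by have /andP[] := f0M x.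
have bf : norm_bounded f by exists M => x; rewrite ger0_norm//; have /andP[] := f0M x.
apply/lee_addgt0Pr => delta delta0.
pose C k := [set x | delta * k.+1%:R <= f x].
have mC k : measurable (C k).
  have -> : C k = f @^-1` `[delta * k.+1%:R, +oo[.
    by apply/seteqP; split => x /=; rewrite in_itv/= andbT.
  by rewrite -[X in measurable X]setTI; exact: mf.
(* [h n] is [layers n] composed with [f], as a recursion on functions, so that [Lambda] and the
   integral split off one indicator at a time. *)
pose fix h (n : nat) : Y -> R := if n is k.+1 then delta *: \1_(C k) + h k else cst 0.
have hE n x : h n x = \sum_(k < n) delta * (delta * k.+1%:R <= f x)%R%:R.
  elim: n => [|n IH]; first by rewrite big_ord0.
  rewrite big_ord_recr/= -IH addrC !fctE indicE.
  by have -> : (x \in C n) = (delta * n.+1%:R <= f x) by apply/idP/idP; rewrite inE.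
have bh n : norm_bounded (h n).
  elim: n => [|n IH] /=; first exact: norm_bounded_cst.
  by apply: norm_bounded_lin => //; exact: norm_bounded_indic.
have mh n : measurable_fun setT (h n).
  elim: n => [|n IH] /=; first exact: measurable_cst.
  by apply: measurable_funD => //; apply: measurable_funM => //; exact: measurable_indic.
have h0 n x : 0 <= h n x.
  by rewrite hE sumr_ge0// => i _; rewrite mulr_ge0// ltW.
have Lh n : ((Lambda (h n))%:E <= \int[mu]_x (h n x)%:E)%E.
  elim: n => [|n IH] /=.
    have -> : Lambda (cst 0) = 0.
      have := Lambda_lin (-1) (norm_bounded_cst Y 0) (norm_bounded_cst Y 0).
      rewrite mulN1r addNr => L0; rewrite -[RHS]L0; congr Lambda.
      by apply/funext => x; rewrite !fctE addr0 [RHS]mulr0.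
    by rewrite integral0.
  rewrite Lambda_lin//; last exact: norm_bounded_indic.
  have dC0 x : (0 <= (delta * \1_(C n) x)%:E)%E by rewrite lee_fin mulr_ge0// ltW.
  have mdC : measurable_fun setT (fun x => (delta * \1_(C n) x)%:E).
    by apply/measurable_EFinP/measurable_funM => //; exact: measurable_indic.
  rewrite (eq_integral (fun x => (delta * \1_(C n) x)%:E + (h n x)%:E)%E)//.
  rewrite ge0_integralD//; last 2 first.
    by move=> x _; rewrite lee_fin.
    exact/measurable_EFinP.
  rewrite EFinD leeD// (integralZl_indic _ (fun=> C n))//; last first.
    by move=> /(lt_trans delta0); rewrite ltxx.
  by rewrite integral_indic// setIT EFinM lee_pmul2l// Lmu.
(* This gives [M <= delta (n + 1)], so the upper estimate of [layers_approx] applies to every value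
   of [f]. *)
pose n := Num.truncn (M / delta).
have fn x : h n x <= f x <= h n x + delta.
  have [fx1 fx2] := layers_approx delta0 n (f0 x).
  rewrite hE fx1 fx2//; have /andP[_ /le_trans->] // := f0M x.
  by rewrite mulrC -ler_pdivrMr// ltW// truncnS_gt.
have Lf : Lambda f <= Lambda (h n) + delta.
  have -> : Lambda (h n) + delta = Lambda (delta *: cst 1 + h n).
    by rewrite Lambda_lin ?Lambda1 ?mulr1 1?addrC//; exact: norm_bounded_cst.
  apply: Lambda_le => //.
    by apply: norm_bounded_lin => //; exact: norm_bounded_cst.
  move=> x; rewrite !fctE [_ *: _]mulr1 addrC.
  by have /andP[] := fn x.
apply: (@le_trans _ _ (Lambda (h n) + delta)%:E); first by rewrite lee_fin.
rewrite EFinD leeD2r// (le_trans (Lh n))//.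
apply: ge0_le_integral => //.
- by move=> x _; rewrite lee_fin.
- exact/measurable_EFinP.
- exact/measurable_EFinP.
- by move=> x _; rewrite lee_fin; have /andP[] := fn x.
Qed.

End integral_ge.

(** * The space of bounded characters *)

(** A filter on the subspace is pushed forward to [X]; its cluster point in [B] is one for the
    original filter, since open sets of the subspace are traces of open sets of [X]. *)
Lemma compact_set_type (X : topologicalType) (B : set X) :
  compact B -> compact [set: B].
Proof.
move=> cB F FF FT.
pose G : set_system X := [set U | F (set_val @^-1` U)].
have GP : ProperFilter G.
  split; first exact: filter_not_empty.
  split=> [|U V GU GV|U V UV]; first exact: filterT.
    exact: (filterI GU GV).
  by rewrite /G /=; apply: filterS => x; exact: UV.
have GB : G B by rewrite /G /=; apply: filterS FT => -[x xB] _; exact: set_mem.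
have [p [Bp clp]] := cB G GP GB.
exists (SigSub (mem_set Bp)); split => // U V FU [_ [[W oW <-] Wp] WV].
have GU : G (set_val @` U) by rewrite /G /=; apply: filterS FU => x Ux; exists x.
have [|_ [[x Ux <-] Wx]] := clp _ _ GU (_ : nbhs p W).
  by apply: open_nbhs_nbhs; split.
by exists x; split => //; exact: WV.
Qed.

Lemma borel_continuous_measurable (R : realType) (X : topologicalType) (x0 : X)
    (f : X -> R) :
  continuous f -> measurable_fun setT (f : borel_type x0 -> R).
Proof.
move=> /continuousP cf; apply: (measurability _ (RGenOpens.measurableE R)).
move=> _ [_ [a [b ->] <-]]; rewrite setTI; apply: sub_sigma_algebra.
exact/cf/interval_open.
Qed.

Section bounded_character_space.
Variables (R : realType) (A : comAlgType R) (T : A -> R).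
Let K := bounded_characters T.

Definition char_eval (a : A) (x : K) : R := (\val x : A -> R) a.

Let charE (x : K) : characters A (\val x) /\ (forall a, `|char_eval a x| <= T a).
Proof. by have := set_valP x. Qed.

Lemma char_eval_linear : linear char_eval.
Proof.
move=> c a b; apply/funext => x; rewrite !fctE.
by have [/charactersP[_ _ lin] _] := charE x; exact: lin.
Qed.

Lemma char_eval1 : char_eval 1 = cst 1.
Proof. by apply/funext => x; have [/charactersP[e1 _ _] _] := charE x; exact: e1. Qed.

Lemma char_evalM a b x : char_eval (a * b) x = char_eval a x * char_eval b x.
Proof. by have [/charactersP[_ eM _] _] := charE x; exact: eM. Qed.

Lemma char_eval_le a x : `|char_eval a x| <= T a.
Proof. exact: (charE x).2. Qed.

Lemma char_eval_continuous a : continuous (char_eval a : K -> R).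
Proof.
move=> x; apply: (@continuous_comp K {ptws A -> R} R set_val (fun f => f a)).
  exact: (@initial_continuous K {ptws A -> R} set_val).
exact: (@proj_continuous A (fun=> R) a).
Qed.

Lemma char_eval_norm_bounded a : norm_bounded (char_eval a).
Proof. by exists (T a); exact: char_eval_le. Qed.

Lemma bounded_charactersT_compact : compact [set: K].
Proof. exact/compact_set_type/bounded_characters_compact. Qed.

End bounded_character_space.

(** * Equivalence of moment positivity and integral representation *)

Lemma positive_on_characters (R : realType) (A : comAlgType R) (L : {scalar A})
    (T : A -> R) : L 1 = 1 -> (forall a, 0 < T a) ->
  (forall a p q, 0 <= L (((T a)%:A - a) ^+ p * ((T a)%:A + a) ^+ q)) ->
  forall a, (forall x : bounded_characters T, 0 <= char_eval a x) -> 0 <= L a.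
Proof.
move=> L1 T_gt0 LT a a_ge0; apply/ler_addgt0Pr => eps eps0.
(* Adding [eps] makes [a] strictly positive on the bounded characters, as required for the
   representation theorem in the semiring of [tame_stable] elements. *)
suff /(tame_stable_ge0 T_gt0 L1 LT) : tame_stable L T (a + eps%:A).
  by rewrite linearD linearZ /= L1 mulr1.
apply: arch_positivstellensatz.
- exact: tame_stableD.
- exact: tame_stableM.
- exact: tame_stable_scalar.
- by move=> b; exists (T b); have [] := tame_stable_gen L T_gt0 b.
move=> alpha chi alpha_ge0; have /charactersP[alpha1 _ lin] := chi.
(* Both [T b + b] and [T b - b] lie in the semiring, so [alpha] is nonnegative on them. *)
have alphaT : bounded_characters T alpha.
  split=> // b; have [] := tame_stable_gen L T_gt0 b.
  move=> /alpha_ge0 + /alpha_ge0.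
  rewrite lin alpha1 mulr1 ler_norml.
  have := lin (-1) b (T b)%:A; rewrite scaleN1r [- b + _]addrC => ->.
  have := lin (T b) 1 0; rewrite !addr0.
  have := lin (-1) 0 0; rewrite scaleN1r addNr alpha1.
  by move=> a00 aTb tb1 tb2; apply/andP; split; lra.
have := a_ge0 (SigSub (mem_set alphaT)); rewrite /char_eval/= => alpha_a.
by rewrite addrC lin alpha1 mulr1 ltr_wpDr.
Qed.

Lemma nneg_of_character_measure (R : realType) (A : comAlgType R) (T : A -> R)
    (x0 : bounded_characters T)
    (mu : {measure set (borel_type x0) -> \bar R}) (L : A -> R) :
  (forall a, (L a)%:E =
     (\int[mu]_(x in [set: borel_type x0]) (char_eval a x)%:E)%E) ->
  forall a p q, 0 <= L (((T a)%:A - a) ^+ p * ((T a)%:A + a) ^+ q).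
Proof.
move=> Lmu a p q; rewrite -lee_fin Lmu; apply: integral_ge0 => x _.
have char_exp b n : char_eval (b ^+ n) x = char_eval b x ^+ n.
  by elim: n => [|n IH]; rewrite ?expr0 ?char_eval1// !exprS char_evalM IH.
have lin c b d : char_eval (c *: b + d) x = c * char_eval b x + char_eval d x.
  by rewrite char_eval_linear.
have evN b : char_eval (- b) x = - char_eval b x.
  have := lin (-1) 0 0; rewrite scaleN1r addNr => ev0.
  by rewrite -[- b]addr0 -scaleN1r lin ev0; lra.
have /ler_normlP[T1 T2] := char_eval_le a x.
rewrite lee_fin char_evalM !char_exp mulr_ge0// exprn_ge0//.
  have -> : char_eval ((T a)%:A - a) x = T a - char_eval a x.
    by rewrite lin char_eval1 /= mulr1 evN.
  by lra.
have -> : char_eval ((T a)%:A + a) x = T a + char_eval a x.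
  by rewrite lin char_eval1 /= mulr1.
by lra.
Qed.

Lemma character_measure_exists (R : realType) (A : comAlgType R) (L : {scalar A})
    (T : A -> R) : L 1 = 1 ->
  (forall a, (forall x : bounded_characters T, 0 <= char_eval a x) -> 0 <= L a) ->
  exists (x0 : bounded_characters T)
         (mu : {measure set (borel_type x0) -> \bar R}),
    radon_measure mu /\ forall a, (L a)%:E =
      (\int[mu]_(x in [set: borel_type x0]) (char_eval a x)%:E)%E.
Proof.
move=> L1 L_ge0.
(* On an empty space [-1] would be vacuously nonnegative, although [L (- 1) = - 1]. *)
have [x0 _] : exists x0 : bounded_characters T, True.
  apply: contrapT => noK; have : 0 <= L (- 1) by apply: L_ge0 => x; exfalso; apply: noK; exists x.
  by rewrite linearN L1 lerNr oppr0 ler10.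
pose K : Type := bounded_characters T.
pose ev : {linear A -> (K -> R)} := HB.pack (@char_eval R A T : A -> (K -> R))
  (GRing.isLinear.Build R A (K -> R) *:%R (@char_eval R A T) (@char_eval_linear R A T)).
have [Lambda [LambdaE Lambda_ge0 Lambda_lin]] :=
  @positive_extension R K A L ev 1 L1 (@char_eval1 R A T) L_ge0.
have Lambda1 : Lambda (cst 1) = 1.
  by rewrite -[RHS]L1 -LambdaE; congr Lambda; exact/esym/char_eval1.
pose nu (B : set K) := Lambda \1_B.
have nu_ge0 B : 0 <= nu B.
  by apply: Lambda_ge0; [move=> x; rewrite indicE|exact: norm_bounded_indic].
have nuU B C : B `&` C = set0 -> nu (B `|` C) = nu B + nu C.
  move=> BC; rewrite -[nu B]mul1r -Lambda_lin; try exact: norm_bounded_indic.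
  congr Lambda; apply/funext => x; rewrite !fctE scale1r !indicE in_setU.
  have := congr1 (fun D => x \in D) BC; rewrite in_setI in_set0.
  by case: (x \in B); case: (x \in C); rewrite ?addr0 ?add0r.
have [mu [mu_radon muT nu_mu]] := content_regularization x0
  (@bounded_characters_hausdorff R A T) (@bounded_charactersT_compact R A T) nu_ge0 nuU.
exists x0, mu; split=> // a.
have {}muT : mu setT = 1%E.
  rewrite muT /nu; congr EFin; rewrite -[RHS]Lambda1; congr Lambda.
  exact: indicT.
have mev b : measurable_fun setT (char_eval b : borel_type x0 -> R).
  exact: (borel_continuous_measurable (@char_eval_continuous R A T b)).
have iev b : mu.-integrable setT (EFin \o (char_eval b : borel_type x0 -> R)).
  apply: measurable_bounded_integrable => //; first by rewrite muT ltry.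
  exists (T b); split=> [|r Tr x _]; first exact: num_real.
  exact: le_trans (char_eval_le b x) (ltW Tr).
have L_le b : ((L b)%:E <= \int[mu]_(x in [set: borel_type x0]) (char_eval b x)%:E)%E.
  have bT := char_eval_norm_bounded T b.
  (* The shift by [T b] makes the function nonnegative. It adds [T b] to both sides, as
     [Lambda (cst 1)] and the mass of [mu] are both 1. *)
  pose f : borel_type x0 -> R := T b *: cst 1 + char_eval b.
  have fE x : f x = T b + char_eval b x by rewrite /f !fctE [_ *: _]mulr1.
  have mf : measurable_fun setT f.
    by apply: measurable_funD => //; apply: measurable_funM.
  have Lf : Lambda f = T b + L b.
    rewrite (Lambda_lin _ _ _ (norm_bounded_cst _ 1) bT) Lambda1 mulr1.
    by congr (_ + _); exact: LambdaE.
  have f_bd x : 0 <= f x <= T b + T b.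
    have /ler_normlP[h1 h2] := char_eval_le b x.
    by rewrite fE; apply/andP; split; lra.
  have f_layer r : ((Lambda \1_[set x | (r <= f x)%R])%:E <= mu [set x | (r <= f x)%R])%E.
    apply: nu_mu; have -> : [set x : bounded_characters T | r <= f x] =
        (char_eval b : bounded_characters T -> R) @^-1` [set y | r - T b <= y].
      by apply/seteqP; split=> x /=; rewrite fE lerBlDl.
    exact: (proj1 (continuous_closedP _) (@char_eval_continuous R A T b) _ (@closed_ge R _)).
  have := @integral_ge_positive_functional R _ (borel_type x0) mu Lambda
    Lambda_ge0 Lambda_lin Lambda1 f _ mf f_bd f_layer.
  rewrite Lf (eq_integral (fun x : borel_type x0 => (T b)%:E + (char_eval b x)%:E)%E); last first.
    by move=> x _; rewrite fE.
  rewrite integralD//; first last.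
    exact: iev.
    by apply: measurable_bounded_integrable => //; [rewrite muT ltry|exact: bounded_cst].
  by rewrite integral_cst// muT mule1 EFinD leeD2lE.
(* The reverse inequality is [L_le] at [- a]. *)
apply/eqP; rewrite eq_le L_le /=.
have := L_le (- a); rewrite linearN EFinN.
rewrite (eq_integral (fun x : borel_type x0 => - (char_eval a x)%:E)%E); last first.
  move=> x _; rewrite -EFinN; congr EFin.
  by have := congr1 (fun g => g x) (linearN ev a).
rewrite integralN; last exact/integrable_add_def/iev.
by rewrite leeN2.
Qed.

Theorem theorem3p2 (R : realType) (A : comAlgType R)
    (X_neq0 : characters A !=set0)
    (L : {scalar A}) (L1 : L 1 = 1)
    (T : A -> R) (T_gt0 : forall a : A, 0 < T a) :
  (forall (a : A) (p q : nat),
     0 <= L (((T a)%:A - a) ^+ p * ((T a)%:A + a) ^+ q))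
  <->
  (exists (alpha0 : bounded_characters T)
          (mu : {measure set (borel_type alpha0) -> \bar R}),
     radon_measure mu /\
     forall a : A,
       (L a)%:E = (\int[mu]_(alpha in [set: borel_type alpha0])
                     ((\val (alpha : bounded_characters T) : A -> R) a)%:E)%E).
Proof.
split=> [LT|[x0 [mu [_ Lmu]]]]; last exact: nneg_of_character_measure Lmu.
exact/character_measure_exists/positive_on_characters.
Qed.
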